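(* If finite simple graphs $G$ and $H$ are homeomorphic, then $G\in\mathcal{U}$ if and only if $H\in\mathcal{U}$.
   Context: Let $V$ be a finite set of Boolean variables. A clause is a disjunction of literals from $V\cup\neg V\cup\{\top,\bot\}$; a CNF is a conjunction of clauses; it is reduced if unchanged under the rules $x\vee\top=\top$, $x\vee\bot=x$, $x\wedge\top=x$, $x\wedge\bot=\bot$, $x\vee x=x$, $x\wedge x=x$, $\neg\neg x=x$, $x\vee\neg x=\top$. A nontrivial reduced 2-CNF is a reduced CNF other than $\top,\bot$ all of whose clauses have exactly two literals. With $|x|=|\neg x|=x$, its associated multigraph has as vertices the variables occurring in it and one edge $\{|a|,|b|\}$ per clause $(a\vee b)$. The 2-CNF is simple if this multigraph has no multiple edges, in which case the graph is denoted $\mathcal{G}(S)$. $\mathcal{U}$ is the family of graphs $\mathcal{G}(S)$ with $S$ an unsatisfiable simple 2-CNF (unsatisfiable: no truth assignment makes it true). A subdivision of an edge $(u,v)$ replaces it by a new vertex $w$ and edges $(u,w),(w,v)$; a subdivision of a graph is obtained by repeated edge subdivisions; two graphs are homeomorphic if they are subdivisions of the same graph. *)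

(* Defs.v *)
From HB Require Import structures.
From mathcomp Require Import all_boot.

Set Implicit Arguments.
Unset Strict Implicit.
Unset Printing Implicit Defensive.

(** * Finite simple graphs *)

Record sgraph := SGraph {
  vertex :> finType;
  adj : rel vertex;
  adj_sym : symmetric adj;
  adj_irr : irreflexive adj }.

Definition graph_iso (G H : sgraph) : Prop :=
  exists2 f : G -> H, bijective f & forall x y, adj (f x) (f y) = adj x y.

(** [None] is the new vertex; the construction is the subdivision of the edge
    [(u, v)] when [adj u v], and is only used in that case. *)
Definition subdivide_adj (G : sgraph) (u v : G) : rel (option G) :=
  fun p q => match p, q with
  | Some x, Some y => adj x y && ([set x; y] != [set u; v])
  | Some x, None | None, Some x => (x == u) || (x == v)
  | None, None => false
  end.

Fact subdivide_sym (G : sgraph) (u v : G) : symmetric (subdivide_adj u v).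
Proof. by move=> [x|] [y|] //=; rewrite adj_sym setUC. Qed.

Fact subdivide_irr (G : sgraph) (u v : G) : irreflexive (subdivide_adj u v).
Proof. by move=> [x|] //=; rewrite adj_irr. Qed.

Definition subdivide (G : sgraph) (u v : G) : sgraph :=
  SGraph (subdivide_sym u v) (subdivide_irr u v).

(** [subdivision G H]: up to isomorphism, [H] arises from [G] by finitely many
    (possibly zero) successive edge subdivisions. *)
Inductive subdivision (G : sgraph) : sgraph -> Prop :=
| subdivision_iso (H : sgraph) : graph_iso G H -> subdivision G H
| subdivision_step (H : sgraph) (u v : H) (H' : sgraph) :
    subdivision G H -> adj u v -> graph_iso (subdivide u v) H' ->
    subdivision G H'.

Definition homeomorphic (G H : sgraph) : Prop :=
  exists2 K : sgraph, subdivision K G & subdivision K H.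

(** * CNFs *)

Inductive literal (V : Type) := Pos of V | Neg of V | Top | Bot.
Arguments Top {V}.
Arguments Bot {V}.

Section LiteralEqType.
Variable V : eqType.

Definition literal_code (l : literal V) : V + V + bool :=
  match l with
  | Pos x => inl (inl x)
  | Neg x => inl (inr x)
  | Top => inr true
  | Bot => inr false
  end.

Definition literal_decode (s : V + V + bool) : literal V :=
  match s with
  | inl (inl x) => Pos x
  | inl (inr x) => Neg x
  | inr b => if b then Top else Bot
  end.

Fact literal_codeK : cancel literal_code literal_decode.
Proof. by case. Qed.

HB.instance Definition _ := Equality.copy (literal V) (can_type literal_codeK).
End LiteralEqType.

(** Negation is a function on literals, so the rule [¬¬x = x] holds by
    computation. *)
Definition neg (V : Type) (l : literal V) : literal V :=
  match l with
  | Pos x => Neg x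
  | Neg x => Pos x
  | Top => Bot
  | Bot => Top
  end.

(** [lit_var l] is |l|; the constants have no variable. *)
Definition lit_var (V : Type) (l : literal V) : option V :=
  match l with
  | Pos x | Neg x => Some x
  | Top | Bot => None
  end.

(** A sequence of literals stands for their disjunction, a sequence of clauses
    for their conjunction. *)
Definition clause (V : Type) := seq (literal V).
Definition cnf (V : Type) := seq (clause V).

(** Equality of CNFs up to associativity and commutativity of both connectives. *)
Definition cnf_AC (V : eqType) (S S' : cnf V) : Prop :=
  exists2 T : cnf V, perm_eq S T & all2 (fun c d : clause V => perm_eq c d) T S'.

(** The reduction rules, read from left to right, acting at the head of a CNF. *)
Inductive cnf_rule (V : eqType) : cnf V -> cnf V -> Prop :=
| or_top x c S   : cnf_rule ((x :: Top :: c) :: S)   ((Top :: c) :: S)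
| or_bot x c S   : cnf_rule ((x :: Bot :: c) :: S)   ((x :: c) :: S)
| or_idem x c S  : cnf_rule ((x :: x :: c) :: S)     ((x :: c) :: S)
| or_compl x c S : cnf_rule ((x :: neg x :: c) :: S) ((Top :: c) :: S)
| and_top C S    : cnf_rule (C :: [:: Top] :: S)     (C :: S)
| and_bot C S    : cnf_rule (C :: [:: Bot] :: S)     ([:: Bot] :: S)
| and_idem C S   : cnf_rule (C :: C :: S)            (C :: S).

(** Every rule strictly decreases the number of literals or of clauses, so being
    unchanged under the rules amounts to no rule being applicable. *)
Definition reduced (V : eqType) (S : cnf V) : Prop :=
  forall S' S'' : cnf V, cnf_AC S S' -> ~ cnf_rule S' S''.

(** The empty conjunction is another form of ⊤. *)
Definition nontrivial (V : eqType) (S : cnf V) : bool :=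
  S \notin [:: [::]; [:: [:: Top]]; [:: [:: Bot]]].

Definition nontrivial_reduced_2cnf (V : eqType) (S : cnf V) : Prop :=
  [/\ reduced S, nontrivial S & all (fun c => size c == 2) S].

Definition eval_literal (V : Type) (a : V -> bool) (l : literal V) : bool :=
  match l with
  | Pos x => a x
  | Neg x => ~~ a x
  | Top => true
  | Bot => false
  end.

Definition eval_cnf (V : Type) (a : V -> bool) (S : cnf V) : bool :=
  all (has (eval_literal a)) S.

Definition unsatisfiable (V : Type) (S : cnf V) : Prop :=
  forall a : V -> bool, ~~ eval_cnf a S.

(** * The (multi)graph of a 2-CNF *)

(** For a clause [a ∨ b] on variables this is {|a|, |b|}. *)
Definition clause_edge (V : finType) (c : clause V) : {set V} :=
  [set x | Some x \in map (@lit_var V) c].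

Definition cnf_vars (V : finType) (S : cnf V) : {set V} :=
  [set x | has (fun c => x \in clause_edge c) S].

(** The edges of the associated multigraph, listed with multiplicity. *)
Definition cnf_edges (V : finType) (S : cnf V) : seq {set V} :=
  map (@clause_edge V) S.

Definition simple_cnf (V : finType) (S : cnf V) : bool := uniq (cnf_edges S).

(** A reduced 2-CNF has no loops, so that [x != y] is only needed to make
    [cnf_graph] a simple graph for every [S]. *)
Definition cnf_adj (V : finType) (S : cnf V) : rel {x : V | x \in cnf_vars S} :=
  fun x y => (x != y) && ([set val x; val y] \in cnf_edges S).

Fact cnf_adj_sym (V : finType) (S : cnf V) : symmetric (@cnf_adj V S).
Proof. by move=> x y; rewrite /cnf_adj eq_sym setUC. Qed.

Fact cnf_adj_irr (V : finType) (S : cnf V) : irreflexive (@cnf_adj V S).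
Proof. by move=> x; rewrite /cnf_adj eqxx. Qed.

Definition cnf_graph (V : finType) (S : cnf V) : sgraph :=
  SGraph (@cnf_adj_sym V S) (@cnf_adj_irr V S).

(** The family of graphs of unsatisfiable simple 2-CNFs, closed under
    isomorphism. *)
Definition in_U (G : sgraph) : Prop :=
  exists (V : finType) (S : cnf V),
    [/\ nontrivial_reduced_2cnf S, simple_cnf S, unsatisfiable S
      & graph_iso G (cnf_graph S)].

(* Main.v *)
Require Import Defs.
From mathcomp Require Import all_boot.

(** A graph is in [U] iff it has no isolated vertex and its edges can be labelled
    by 2-clauses on their endpoints that are jointly unsatisfiable.  If the edge
    [uv] is subdivided by [w], a clause [l_u \/ l_v] is traded for the clauses
    [l_u \/ w] and [~ w \/ l_v], of which it is the resolvent; conversely, the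
    clauses on [uw] and [wv] are traded for [l_u \/ l_v], since an assignment
    making [l_u] or [l_v] true extends to [w] so as to satisfy both. *)

Set Implicit Arguments.
Unset Strict Implicit.
Unset Printing Implicit Defensive.

(** [s x y] is the value of [x] that satisfies the clause on the edge [xy]. *)
Definition unsat_signing (G : sgraph) (s : G -> G -> bool) : Prop :=
  forall a : G -> bool,
    exists x y, [/\ adj x y, a x != s x y & a y != s y x].

(** The vertices of [cnf_graph S] are the variables occurring in [S], so each of them lies on an
    edge. Values of [s] at non-adjacent pairs are irrelevant. *)
Definition unsat_signable (G : sgraph) : Prop :=
  (forall x : G, exists y, adj x y) /\ (exists s : G -> G -> bool, unsat_signing s).

Lemma graph_iso_sym (G H : sgraph) : graph_iso G H -> graph_iso H G.
Proof.
case=> f [g fK gK] fadj; exists g; first by exists f.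
by move=> x y; rewrite -fadj !gK.
Qed.

Lemma unsat_signable_isoW (G H : sgraph) :
  graph_iso G H -> unsat_signable G -> unsat_signable H.
Proof.
case=> f [g fK gK] fadj [noiso [s sP]]; split=> [x|].
  by have [y xy] := noiso (g x); exists (f y); rewrite -[x]gK fadj.
exists (fun x y => s (g x) (g y)) => a.
have [x [y [xy ax ay]]] := sP (a \o f).
by exists (f x), (f y); rewrite fadj !fK.
Qed.

Lemma unsat_signable_iso (G H : sgraph) :
  graph_iso G H -> (unsat_signable G <-> unsat_signable H).
Proof.
by move=> GH; split; apply: unsat_signable_isoW => //; apply: graph_iso_sym.
Qed.

Lemma set2_eqP (T : finType) (x y z t : T) :
  reflect (x = z /\ y = t \/ x = t /\ y = z) ([set x; y] == [set z; t]).
Proof.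
apply: (iffP eqP) => [/setP e|[[-> ->]|[-> ->]]] //; last by rewrite setUC.
have := e x; have := e y; have := e z; have := e t.
rewrite !inE !eqxx ?orbT /=.
by do 2![case: eqVneq => [->|?] //=]; rewrite ?eqxx ?orbF //=;
   do ?[case: eqVneq => [?|?] //=]; subst; auto.
Qed.

(** * Subdividing an edge and undoing a subdivision *)

Section Subdivide.
Variables (G : sgraph) (u v : G).
Hypothesis uv : adj u v.

Let vu : adj v u. Proof. by rewrite adj_sym. Qed.
Let u_neq_v : u != v. Proof. by apply: contraTneq uv => ->; rewrite adj_irr. Qed.

Lemma unsat_signable_subdivide :
  unsat_signable G -> unsat_signable (subdivide u v).
Proof.
case=> noiso [s sP]; split=> [[x|]|]; last 2 first.
- by exists (Some u); rewrite /= eqxx.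
(* With [w] for [None], both ends keep their literals; [w] occurs positively in the clause on [uw]
   and negatively in the one on [wv]. *)
- pose s' (p q : option G) := match p, q with
    | Some x, Some y => s x y
    | Some x, None => if x == u then s u v else s v u
    | None, Some x => x == u
    | None, None => false
    end.
  exists (s' : subdivide u v -> subdivide u v -> bool) => a.
  have [x [y [xy ax ay]]] := sP (a \o Some).
  have [e|ne] := boolP ([set x; y] == [set u; v]); last first.
    by exists (Some x), (Some y); rewrite /= xy ne.
  have {x y xy ax ay e} [au av] : a (Some u) != s u v /\ a (Some v) != s v u.
    by case/set2_eqP: e ax ay => -[-> ->].
  (* Both literals of the old clause are false, so the value of [w] decides which new clause fails:
     the one on [wv] if [w] is true, the one on [uw] if it is false. *)
  case aw: (a None).
    by exists (Some v), None; rewrite /= aw eqxx orbT (eq_sym v u) (negPf u_neq_v).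
  by exists (Some u), None; rewrite /= aw !eqxx.
have [y xy] := noiso x.
have [/set2_eqP e|ne] := boolP ([set x; y] == [set u; v]).
  by exists None => /=; case: e => -[-> _]; rewrite eqxx ?orbT.
by exists (Some y); rewrite /= xy.
Qed.

Lemma unsat_signable_unsubdivide :
  unsat_signable (subdivide u v) -> unsat_signable G.
Proof.
case=> noiso [s sP]; split=> [x|].
  have [[y|]] := noiso (Some x); first by case/andP; exists y.
  by case/orP=> /eqP ->; [exists v | exists u].
(* The resolvent: on [uv], each end keeps the literal it has in its clause with [w]. *)
pose s' x y := if [set x; y] == [set u; v] then s (Some x) None
               else s (Some x) (Some y).
exists s' => a.
have s'uv : s' u v = s (Some u) None by rewrite /s' eqxx.
have s'vu : s' v u = s (Some v) None by rewrite /s' setUC eqxx.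
have [/andP[au av]|] := boolP ((a u != s' u v) && (a v != s' v u)).
  by exists u, v.
rewrite s'uv s'vu negb_and !negbK => sat_uv.
(* If [u] already satisfies the clause on [uw], then [w] is free to satisfy the one on [wv].
   Otherwise [w] satisfies the clause on [uw], and [sat_uv] makes [v] satisfy the other. *)
pose w := if a u == s (Some u) None then s None (Some v) else s None (Some u).
have w_sat z : z = u \/ z = v -> a z != s (Some z) None -> w = s None (Some z).
  by rewrite /w; case=> ->; case: eqP sat_uv => //= _ /eqP ->; rewrite eqxx.
(* By [w_sat], the edge falsified by the extended assignment cannot meet [w]; it is an edge of [G]
   other than [uv], where [s'] agrees with [s]. *)
have [[x|] [[y|] [//= xy ax ay]]] :=
  sP (fun p : option G => if p is Some x then a x else w).
- case/andP: xy => xy ne; exists x, y; split=> //; rewrite /s'.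
    by rewrite (negPf ne).
  by rewrite setUC (negPf ne).
- by rewrite (w_sat x) ?eqxx // in ay; case/orP: xy => /eqP; auto.
- by rewrite (w_sat y) ?eqxx // in ax; case/orP: xy => /eqP; auto.
Qed.

End Subdivide.

Lemma unsat_signable_subdivision (G H : sgraph) :
  subdivision G H -> (unsat_signable G <-> unsat_signable H).
Proof.
elim=> [{}H|{}H u v H' _ GH uv sub_iso]; first exact: unsat_signable_iso.
apply: iff_trans (unsat_signable_iso sub_iso); apply: iff_trans GH _.
split; first exact: unsat_signable_subdivide.
exact: unsat_signable_unsubdivide.
Qed.

(** * Reduced 2-CNFs in terms of their clauses *)

Section Clauses.
Variable V : finType.
Implicit Types (S : cnf V) (c : clause V) (b : bool) (x y : V).

Definition lit b x : literal V := if b then Pos x else Neg x.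

Lemma lit_var_lit b x : lit_var (lit b x) = Some x.
Proof. by case: b. Qed.

Lemma eval_lit a b x : eval_literal a (lit b x) = (a x == b).
Proof. by case: b => /=; case: (a x). Qed.

(** Counting variables excludes constants, repeated literals and complementary literals all at
    once. *)
Definition proper_clause c : bool := (size c == 2) && (#|clause_edge c| == 2).

Lemma clause_edge_lit2 b x b' y : clause_edge [:: lit b x; lit b' y] = [set x; y].
Proof. by apply/setP => z; rewrite !inE !lit_var_lit. Qed.

Lemma proper_clauseP c :
  reflect (exists b x b' y, x != y /\ c = [:: lit b x; lit b' y])
          (proper_clause c).
Proof.
apply: (iffP idP) => [|[b [x [b' [y [xy ->]]]]]]; last first.
  by rewrite /proper_clause clause_edge_lit2 cards2 xy.
case: c => [|l [|l' [|? ?]]] //; rewrite /proper_clause /= => card2.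
have litE (k : literal V) : (exists b x, k = lit b x) \/ lit_var k = None.
  by case: k => [x|x||]; [left; exists true, x|left; exists false, x|right|right].
(* A literal contributes at most one variable, so two variables in a clause of size two leave no
   room for a constant. *)
have card1 (k : literal V) : #|[set z | Some z == lit_var k]| <= 1.
  by apply/card_le1_eqP => x y; rewrite !inE => /eqP ex /eqP ey;
     move: ex; rewrite -ey; case.
case: (litE l) => [[b [x lE]]|lE]; last first.
  have := card1 l'; suff -> : [set z | Some z == lit_var l'] = clause_edge [:: l; l'].
    by rewrite (eqP card2).
  by apply/setP => z; rewrite !inE lE.
case: (litE l') => [[b' [y l'E]]|l'E]; last first.
  have := card1 l; suff -> : [set z | Some z == lit_var l] = clause_edge [:: l; l'].
    by rewrite (eqP card2).
  by apply/setP => z; rewrite !inE l'E orbF.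
exists b, x, b', y; split; last by rewrite lE l'E.
by apply: contraTneq card2 => xy; rewrite lE l'E clause_edge_lit2 cards2 xy eqxx.
Qed.

Lemma perm_clause_edge c c' : perm_eq c c' -> clause_edge c = clause_edge c'.
Proof.
by move=> /(perm_map (@lit_var V))/perm_mem e; apply/setP => x; rewrite !inE e.
Qed.

(** [reduced] quantifies over all rearrangements of [S]; this invariance makes it enough to exclude
    rules at the head of one of them. *)
Lemma cnf_AC_proper S S' : cnf_AC S S' ->
  all proper_clause S -> simple_cnf S -> all proper_clause S' && simple_cnf S'.
Proof.
case=> T ST TS'.
rewrite (perm_all _ ST) /simple_cnf /cnf_edges (perm_uniq (perm_map _ ST)).
have -> : map (@clause_edge V) T = map (@clause_edge V) S'.
  by elim: T S' TS' {ST} => [|c T IH] [|d S'] //= /andP[/perm_clause_edge -> /IH ->].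
move=> + ->; rewrite andbT.
elim: T S' TS' {ST} => [|c T IH] [|d S'] //= /andP[cd TS'] /andP[cP TP].
rewrite (IH _ TS' TP) andbT.
by rewrite /proper_clause -(perm_size cd) -(perm_clause_edge cd).
Qed.

(** The disjunction rules need a constant, a repetition or a complementary pair, and [and_top] and
    [and_bot] a clause of size one, none of which is proper. [and_idem] would repeat an edge,
    against simplicity. *)
Lemma proper_reduced S : all proper_clause S -> simple_cnf S -> reduced S.
Proof.
move=> SP Suniq S' S'' SS'; have := cnf_AC_proper SS' SP Suniq.
have properD (x y : literal V) c : proper_clause [:: x, y & c] ->
    [/\ y != Top, y != Bot, x != y & y != neg x].
  case/proper_clauseP=> [b1 [x1 [b2 [x2 [ne [-> -> _]]]]]].
  by case: b1 b2 => -[]; split=> //; apply: contraNneq ne => -[->].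
move=> + r; case: r => [x c|x c|x c|x c|C|C|C] T /andP[/= /andP[P]].
- by case: (properD _ _ _ P); rewrite eqxx.
- by case: (properD _ _ _ P) => _; rewrite eqxx.
- by case: (properD _ _ _ P) => _ _; rewrite eqxx.
- by case: (properD _ _ _ P) => _ _ _; rewrite eqxx.
- by [].
- by [].
- by rewrite /simple_cnf /= inE eqxx.
Qed.

Lemma cnf_AC_to_front S c c' : c \in S -> perm_eq c c' ->
  cnf_AC S (c' :: rem c S).
Proof.
move=> cS cc'; exists (c :: rem c S); first exact: perm_to_rem.
by rewrite /= cc'; elim: (rem c S) => //= d T ->; rewrite perm_refl.
Qed.

Lemma reduced_proper S :
  reduced S -> all (fun c => size c == 2) S -> all proper_clause S.
Proof.
move=> redS size2; apply/allP => c cS.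
case: c cS (allP size2 _ cS) => [|l [|l' []]] // cS _.
have noruleL T : ~ cnf_rule ([:: l; l'] :: rem [:: l; l'] S) T.
  by apply/redS/cnf_AC_to_front; rewrite ?perm_refl.
(* [or_top] and [or_bot] detect a constant only in second position, so a constant [l] is exposed by
   swapping the literals. *)
have noruleR T : ~ cnf_rule ([:: l'; l] :: rem [:: l; l'] S) T.
  by apply/redS/cnf_AC_to_front => //; rewrite (perm_catC [:: l] [:: l']).
have neq : l != l'.
  apply/eqP => e; move: noruleL; rewrite -e => norule.
  by apply: norule; apply: or_idem.
have nneg : l' != neg l.
  apply/eqP => e; move: noruleL; rewrite e => norule.
  by apply: norule; apply: or_compl.
apply/proper_clauseP; clear cS.
case: l l' noruleL noruleR neq nneg => [x|x||] [y|y||] nL nR ne nn;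
  try (by case: (nL _ (or_top _ _ _))); try (by case: (nL _ (or_bot _ _ _)));
  try (by case: (nR _ (or_top _ _ _))); try (by case: (nR _ (or_bot _ _ _))).
- by exists true, x, true, y; split=> //; apply: contraNneq ne => ->.
- by exists true, x, false, y; split=> //; apply: contraNneq nn => ->.
- by exists false, x, true, y; split=> //; apply: contraNneq nn => ->.
- by exists false, x, false, y; split=> //; apply: contraNneq ne => ->.
Qed.

End Clauses.

(** * Translation between 2-CNFs and signings *)

(** Applied to [clause_edge]: in a simple CNF an edge determines its clause. *)
Lemma map_uniq_inj (T1 T2 : eqType) (f : T1 -> T2) (s : seq T1) :
  uniq (map f s) -> {in s &, injective f}.
Proof.
move=> fs_uniq x y xs ys fxy; rewrite -(nth_index x xs) -(nth_index x ys).
congr (nth x s _); apply/eqP.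
rewrite -(nth_uniq (f x) _ _ fs_uniq) ?size_map ?index_mem //.
by rewrite !(nth_map x) ?index_mem // !nth_index // fxy.
Qed.

Lemma cnf_graph_unsat_signable (V : finType) (S : cnf V) :
  all (@proper_clause V) S -> simple_cnf S -> unsatisfiable S ->
  unsat_signable (cnf_graph S).
Proof.
move=> SP Suniq unsatS.
have varS c z : c \in S -> z \in clause_edge c -> z \in cnf_vars S.
  by move=> cS zc; rewrite inE; apply/hasP; exists c.
split=> [[x xS]|].
  have := xS; rewrite inE => /hasP[c cS xc].
  have /proper_clauseP[b [y [b' [z [yz cE]]]]] := allP SP _ cS.
  have eE : clause_edge c = [set y; z] by rewrite cE clause_edge_lit2.
  have yS : y \in cnf_vars S by apply: varS cS _; rewrite eE !inE eqxx.
  have zS : z \in cnf_vars S by apply: varS cS _; rewrite eE !inE eqxx orbT.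
  have edge : [set y; z] \in cnf_edges S by rewrite -eE map_f.
  move: xc; rewrite eE !inE => /orP[] /eqP ex.
    exists (exist _ z zS : cnf_graph S); rewrite /= /cnf_adj /= -val_eqE /= ex yz.
    exact: edge.
  exists (exist _ y yS : cnf_graph S); rewrite /= /cnf_adj /= -val_eqE /= ex.
  by rewrite eq_sym yz setUC.
(* The sign of [x] in the clause on [xy], which [sE] shows to be well defined because that clause is
   unique. *)
pose s (x y : cnf_graph S) :=
  has (fun c => (clause_edge c == [set val x; val y]) && (Pos (val x) \in c)) S.
have sE c (x y : cnf_graph S) : c \in S -> clause_edge c = [set val x; val y] ->
    s x y = (Pos (val x) \in c).
  move=> cS eE; apply/hasP/idP => [[d dS /andP[/eqP dE]]|xc]; last first.
    by exists c => //; rewrite eE eqxx.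
  suff -> : d = c by [].
  by apply: (map_uniq_inj Suniq) => //; rewrite dE.
exists s => a.
(* The default [false] is harmless: it is used only for variables that do not occur in [S]. *)
pose a' z := if insub z is Some x then a x else false.
have a'E (x : cnf_graph S) : a' (val x) = a x by rewrite /a' valK.
have /allPn[c cS] := unsatS a'.
have /proper_clauseP[b [x [b' [y [xy cE]]]]] := allP SP _ cS.
have eE : clause_edge c = [set x; y] by rewrite cE clause_edge_lit2.
have xS : x \in cnf_vars S by apply: varS cS _; rewrite eE !inE eqxx.
have yS : y \in cnf_vars S by apply: varS cS _; rewrite eE !inE eqxx orbT.
rewrite {1}cE /= !eval_lit orbF negb_or => /andP[ax ay].
exists (Sub x xS), (Sub y yS).
rewrite -!a'E /= (sE c) // (sE c) //=; last by rewrite setUC.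
split.
- by rewrite /cnf_adj -val_eqE /= xy -eE map_f.
(* The other literal of [c] is on [y], which differs from [x], so only the first one can be
   [Pos x]. *)
- suff -> : (Pos x \in c) = b by [].
  rewrite cE !inE; case: b b' {cE ax ay} => -[] //=; rewrite ?eqxx //.
  by apply: contraNF xy => /eqP[->].
- suff -> : (Pos y \in c) = b' by [].
  rewrite cE !inE; case: b b' {cE ax ay} => -[] //=; rewrite ?eqxx ?orbT //.
  by rewrite orbF; apply: contraNF xy => /eqP[->].
Qed.

Lemma unsat_signable_in_U (G : sgraph) : unsat_signable G -> in_U G.
Proof.
case=> noiso [s sP].
(* Comparing ranks keeps one orientation of each edge, so that each edge yields exactly one clause
   and the CNF is simple. *)
pose edges := [seq p <- enum {: G * G} |
  adj p.1 p.2 && (enum_rank p.1 < enum_rank p.2)].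
pose cl (p : G * G) := [:: lit (s p.1 p.2) p.1; lit (s p.2 p.1) p.2].
pose S : cnf G := map cl edges.
have clE p : clause_edge (cl p) = [set p.1; p.2] by apply: clause_edge_lit2.
have neq_adj (x y : G) : adj x y -> x != y.
  by apply: contraTneq => ->; rewrite adj_irr.
have edgesP p : p \in edges -> adj p.1 p.2 && (enum_rank p.1 < enum_rank p.2).
  by rewrite mem_filter => /andP[].
have edgeS (x y : G) : adj x y -> exists2 p, p \in edges & p = (x, y) \/ p = (y, x).
  move=> xy; have : enum_rank x != enum_rank y.
    by rewrite (inj_eq enum_rank_inj) neq_adj.
  rewrite -val_eqE neq_ltn => /orP[] lt.
    by exists (x, y); [rewrite mem_filter xy lt mem_enum | left].
  by exists (y, x); [rewrite mem_filter adj_sym xy lt mem_enum | right].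
have cnf_edgesE (x y : G) : ([set x; y] \in cnf_edges S) = adj x y.
  apply/mapP/idP => [[c /mapP[p pE ->]]|xy].
    case/andP: (edgesP _ pE) => pa _; rewrite clE => /eqP/set2_eqP.
    by case=> -[-> ->] //; rewrite adj_sym.
  have [p pE e] := edgeS _ _ xy; exists (cl p); first exact: map_f.
  by rewrite clE; case: e => ->; rewrite //= setUC.
have properS : all (@proper_clause G) S.
  apply/allP => c /mapP[p /edgesP/andP[pa _] ->]; apply/proper_clauseP.
  by exists (s p.1 p.2), p.1, (s p.2 p.1), p.2; rewrite neq_adj.
have simpleS : simple_cnf S.
  rewrite /simple_cnf /cnf_edges -map_comp map_inj_in_uniq.
    by rewrite filter_uniq // enum_uniq.
  move=> [x y] [z t] /edgesP/andP[_ /= xy] /edgesP/andP[_ /= zt].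
  rewrite !clE => /eqP/set2_eqP /= [[-> ->] //|[ex ey]].
  by move: xy zt; rewrite ex ey => /ltn_trans lt /lt; rewrite ltnn.
have unsatS : unsatisfiable S.
  move=> a; have [x [y [xy ax ay]]] := sP a.
  have [p pE e] := edgeS _ _ xy.
  apply/allPn; exists (cl p); first exact: map_f.
  by rewrite /= !eval_lit orbF negb_or; case: e => -> /=; rewrite ?ax ay ?ax.
(* Here the absence of isolated vertices enters: every vertex becomes a variable of [S], so
   [cnf_graph S] has all of [G] as its vertices. *)
have varS x : x \in cnf_vars S.
  have [y /edgeS[p pE e]] := noiso x.
  rewrite inE; apply/hasP; exists (cl p); first exact: map_f.
  by rewrite clE !inE; case: e => ->; rewrite eqxx ?orbT.
exists G, S; split=> //.
  split; first exact: proper_reduced.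
    rewrite /nontrivial !inE !negb_or; apply/and3P; split.
    - by apply/eqP => S0; have := unsatS (fun=> true); rewrite S0.
    - by apply/eqP => S0; move: properS; rewrite S0.
    - by apply/eqP => S0; move: properS; rewrite S0.
  by apply/allP => c /(allP properS)/andP[].
exists (fun x => exist _ x (varS x) : cnf_graph S).
  by exists val => [//|x]; apply: val_inj.
move=> x y; rewrite /= /cnf_adj -val_eqE /= cnf_edgesE.
by apply/andb_idl/neq_adj.
Qed.

Lemma in_UP (G : sgraph) : in_U G <-> unsat_signable G.
Proof.
split; last exact: unsat_signable_in_U.
case=> V [S [[redS _ size2S] simpleS unsatS /graph_iso_sym iso]].
apply: unsat_signable_isoW iso _.
by apply: cnf_graph_unsat_signable => //; apply: reduced_proper.
Qed.

Theorem theorem4 (G H : sgraph) :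
  homeomorphic G H -> (in_U G <-> in_U H).
Proof.
case=> K /unsat_signable_subdivision KG /unsat_signable_subdivision KH.
apply: iff_trans (in_UP G) _; apply: iff_trans (iff_sym (in_UP H)).
exact: iff_trans (iff_sym KG) KH.
Qed.
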